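(* The bisimilarity $\approx$ on networks of the calculus CaIT is contextual: if $M\approx N$ then $M\mid O\approx N\mid O$ for every network $O$ (such that both compositions are well-formed), $(\nu c)M\approx(\nu c)N$ for every channel $c$, and $M[s@h\mapsto v]\approx N[s@h\mapsto v]$ for every sensor $s$, location $h$ and value $v$ in the domain of $s$.
   Context: The calculus CaIT. Fix a set of locations with a distance $d(h,k)\in\mathbb N$ between locations, a constant $\delta\in\mathbb N$, and a function $\mathrm{rng}$ giving each channel $c$ a range $\mathrm{rng}(c)\in\mathbb N\cup\{-1,\infty\}$. Values $v,w$ include basic values, sensor/actuator values and locations; boolean guards $b$ are decidable. Processes: $P,Q::=\mathsf{nil}\mid \rho.P\mid P\parallel Q\mid \lfloor\pi.P\rfloor Q\mid [b]P;Q\mid X\mid \mathsf{fix}\,X.P$ with $\rho\in\{\sigma,\ @(x),\ s?(x),\ a!v\}$ ($s$ a sensor, $a$ an actuator) and $\pi\in\{\overline{c}\langle v\rangle,\ c(x)\}$. The variable $x$ is bound in $c(x).P$, $s?(x).P$, $@(x).P$ and $X$ in $\mathsf{fix}X.P$; in $\sigma.Q$ and $\lfloor\pi.P\rfloor Q$ the occurrence of $Q$ is time-guarded, and in $\mathsf{fix}X.P$ all occurrences of $X$ must be time-guarded. Networks: $M,N::=\mathbf 0\mid n[\mathcal I\bowtie P]^{\mu}_{h}\mid M\mid N\mid (\nu c)M$, where $n$ is a node name, $\mathcal I$ a partial map from sensor and actuator names to values (physical interface), $\mu\in\{\mathsf s,\mathsf m\}$ (stationary/mobile) and $h$ a location.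 Sensors are node-dependent or location-dependent. Networks are closed and well-formed: node names are distinct; distinct nodes have distinct actuators and distinct node-dependent sensors; if $P$ in $n[\mathcal I\bowtie P]^\mu_h$ contains $s?(x)$ (resp. $a!v$) then $\mathcal I(s)$ (resp. $\mathcal I(a)$) is defined; a node whose interface defines a location-dependent sensor is stationary. $T\{v/x\}$ is substitution. Structural congruence $\equiv$ is the least congruence with: $\parallel$ commutative, associative, unit $\mathsf{nil}$; $[b]P;Q\equiv P$ if $b$ true, $\equiv Q$ if $b$ false; $\mathsf{fix}X.P\equiv P\{\mathsf{fix}X.P/X\}$; $P\equiv Q$ implies $n[\mathcal I\bowtie P]^\mu_h\equiv n[\mathcal I\bowtie Q]^\mu_h$; network $\mid$ commutative, associative, unit $\mathbf 0$; $(\nu c)\mathbf 0\equiv\mathbf 0$; $(\nu c)(\nu d)M\equiv(\nu d)(\nu c)M$; $(\nu c)(M\mid N)\equiv M\mid(\nu c)N$ if $c$ not in $M$. Labelled (intensional) semantics. Process transitions $P\xrightarrow{\lambda}P'$, $\lambda\in\{\sigma,\tau,\overline cv,cv,@h,s?v,a!v\}$, with $[b]P;Q$ identified with $P$ if $b$ is true and with $Q$ otherwise, are the least relation closed under: $\lfloor\overline c\langle v\rangle.P\rfloor Q\xrightarrow{\overline cv}P$; $\lfloor c(x).P\rfloor Q\xrightarrow{cv}P\{v/x\}$ (any $v$); $s?(x).P\xrightarrow{s?v}P\{v/x\}$ (any $v$); $a!v.P\xrightarrow{a!v}P$; $@(x).P\xrightarrow{@h}P\{h/x\}$ (any $h$);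 if $P\xrightarrow{\overline cv}P'$, $Q\xrightarrow{cv}Q'$ and $\mathrm{rng}(c)=-1$ then $P\parallel Q\xrightarrow{\tau}P'\parallel Q'$ and $Q\parallel P\xrightarrow{\tau}Q'\parallel P'$; if $P\xrightarrow{\lambda}P'$ with $\lambda\ne\sigma$ then $P\parallel Q\xrightarrow{\lambda}P'\parallel Q$ and $Q\parallel P\xrightarrow{\lambda}Q\parallel P'$; if $P\{\mathsf{fix}X.P/X\}\xrightarrow{\lambda}Q$ then $\mathsf{fix}X.P\xrightarrow{\lambda}Q$; $\mathsf{nil}\xrightarrow{\sigma}\mathsf{nil}$; $\sigma.P\xrightarrow{\sigma}P$; $\lfloor\pi.P\rfloor Q\xrightarrow{\sigma}Q$; if $P\xrightarrow{\sigma}P'$, $Q\xrightarrow{\sigma}Q'$ and $P\parallel Q$ has no $\tau$-transition then $P\parallel Q\xrightarrow{\sigma}P'\parallel Q'$. Network transitions $M\xrightarrow{\nu}M'$, $\nu\in\{\sigma,\tau,a,\overline cv@h,cv@h\}$, are the least relation closed under (for a node $n[\mathcal I\bowtie P]^\mu_h$): if $P\xrightarrow{@h}P'$ then node $\xrightarrow{\tau}n[\mathcal I\bowtie P']^\mu_h$; if $\mathcal I(s)=v$ and $P\xrightarrow{s?v}P'$ then node $\xrightarrow{\tau}n[\mathcal I\bowtie P']^\mu_h$; if $\mathcal I(a)=v$ and $P\xrightarrow{a!v}P'$ then node $\xrightarrow{\tau}n[\mathcal I\bowtie P']^\mu_h$; if $\mathcal I(a)\ne v$ and $P\xrightarrow{a!v}P'$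 then node $\xrightarrow{a}n[\mathcal I[a\mapsto v]\bowtie P']^\mu_h$; if $P\xrightarrow{\tau}P'$ then node $\xrightarrow{\tau}n[\mathcal I\bowtie P']^\mu_h$; if $P\xrightarrow{\sigma}P'$ and the node has no $\tau$-transition then $n[\mathcal I\bowtie P]^{\mathsf s}_h\xrightarrow{\sigma}n[\mathcal I\bowtie P']^{\mathsf s}_h$ and $n[\mathcal I\bowtie P]^{\mathsf m}_h\xrightarrow{\sigma}n[\mathcal I\bowtie P']^{\mathsf m}_k$ for every $k$ with $d(h,k)\le\delta$; if $P\xrightarrow{\overline cv}P'$ (resp. $\xrightarrow{cv}$) and $\mathrm{rng}(c)\ge0$ then node $\xrightarrow{\overline cv@h}$ (resp. $\xrightarrow{cv@h}$) $n[\mathcal I\bowtie P']^\mu_h$; if $M\xrightarrow{\overline cv@k}M'$, $N\xrightarrow{cv@h}N'$ and $d(h,k)\le\mathrm{rng}(c)$ then $M\mid N\xrightarrow{\tau}M'\mid N'$ and $N\mid M\xrightarrow{\tau}N'\mid M'$; if $M\xrightarrow{\nu}M'$, $\nu\ne\sigma$, then $M\mid N\xrightarrow{\nu}M'\mid N$ and $N\mid M\xrightarrow{\nu}N\mid M'$; if $M\xrightarrow{\sigma}M'$, $N\xrightarrow{\sigma}N'$ and $M\mid N$ has no $\tau$-transition then $M\mid N\xrightarrow{\sigma}M'\mid N'$; $\mathbf 0\xrightarrow{\sigma}\mathbf 0$; if $M\xrightarrow{\nu}N$ and $\nu$ is not of the form $\overline cv@h$ or $cv@h$ then $(\nu c)M\xrightarrow{\nu}(\nu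 c)N$. Barb: $M\downarrow_{a!v@h}$ iff $M\equiv(\nu\tilde g)(n[\mathcal I\bowtie P]^\mu_h\mid M')$ with $\mathcal I(a)=v$. Sensor update: $n[\mathcal I\bowtie P]^\mu_h[s@h\mapsto v]=n[\mathcal I[s\mapsto v]\bowtie P]^\mu_h$ if $\mathcal I(s)$ is defined; a node is unchanged if $\mathcal I(s)$ is undefined or it is located at $k\ne h$; the update distributes over $\mid$ and $(\nu c)$, and $\mathbf 0[s@h\mapsto v]=\mathbf 0$. Extensional semantics: the transitions labelled $\tau,\sigma,a$ are those above; in addition (i) if $M\xrightarrow{\overline cv@h}M'$ and $d(h,k)\le\mathrm{rng}(c)$ then $M\xrightarrow{\overline cv\triangleright k}M'$; (ii) if $M\xrightarrow{cv@h}M'$ and $d(k,h)\le\mathrm{rng}(c)$ then $M\xrightarrow{cv\triangleleft k}M'$; (iii) for every sensor $s$, location $h$ and $v$ in the domain of $s$, $M\xrightarrow{s?v@h}M[s@h\mapsto v]$; (iv) if $M\downarrow_{a!v@h}$ then $M\xrightarrow{a!v@h}M$. Let $\alpha$ range over extensional labels. $\Rightarrow$ is $(\xrightarrow{\tau})^*$, $\xRightarrow{\alpha}$ is $\Rightarrow\xrightarrow{\alpha}\Rightarrow$, and $\xRightarrow{\hat\alpha}$ is $\Rightarrow$ if $\alpha=\tau$ and $\xRightarrow{\alpha}$ otherwise. A symmetric relation $\mathcal R$ is a bisimulation if $M\,\mathcal R\,N$ and $M\xrightarrow{\alpha}M'$ imply $N\xRightarrow{\hat\alpha}N'$ with $M'\,\mathcal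 R\,N'$; $\approx$ is the union of all bisimulations.
   Formalization: Well-formed networks are also required to have I(s) in the domain of s whenever I(s) is defined (otherwise the sensor-update clause fails); d is symmetric and each channel range in use has infinitely many channel names, for alpha-conversion of restrictions. *)

(* Defs.v *)
From Stdlib Require Import Relation_Operators.
From mathcomp Require Import all_boot.

Set Implicit Arguments.
Unset Strict Implicit.
Unset Printing Implicit Defensive.

(* The range set N u {-1, oo}: [Internal] is -1. *)
Inductive range := Internal | Within of nat | Unbounded.

Definition in_range (d : nat) (r : range) : bool :=
  match r with Internal => false | Within n => d <= n | Unbounded => true end.

Definition range_ge0 (r : range) : bool :=
  if r is Internal then false else true.

(* [VBase] covers basic, sensor and actuator values. *)
Inductive value (base loc : Type) :=
  | VBase of base
  | VLoc of loc.

Inductive mobility := Stationary | Mobile.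

(* The parameters of the calculus. A guard is a symbol applied to value terms;
   its truth on closed arguments is computed by [guard_eval].
   [rng_fresh] is the infinite supply of channel names on which
   alpha-conversion of (nu c)M relies: a bound channel can only be renamed to
   one with the same range. *)
Record cait := CaIT {
  node_name : eqType;
  chan : eqType;
  sensor : eqType;
  actuator : eqType;
  loc : eqType;
  base_value : Type;
  guard_sym : Type;
  guard_eval : guard_sym -> seq (value base_value loc) -> bool;
  dist : loc -> loc -> nat;
  dist_sym : forall h k, dist h k = dist k h;
  delta : nat;
  rng : chan -> range;
  rng_fresh : forall (c : chan) (cs : seq chan),
    exists2 d, d \notin cs & rng d = rng c;
  loc_dependent : pred sensor;
  sensor_dom : sensor -> value base_value loc -> Prop
}.

Section Calculus.

Context (S : cait).

Local Notation val := (value (base_value S) (loc S)).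

(* Value variables and process variables are two independent families of de
   Bruijn indices; channels are named. *)
Inductive vterm := Val of val | Var of nat.

Definition guard : Type := (guard_sym S * seq vterm)%type.

(* [PLoc P] is @(x).P, [PSense s P] is s?(x).P, [PTIn c P Q] is |c(x).P|Q, each
   binding value index 0 in P (not in Q); [PTOut c v P Q] is |c<v>.P|Q;
   [PFix P] is fix X.P, binding process index 0 in P. *)
Inductive proc :=
  | PNil
  | PSigma of proc
  | PLoc of proc
  | PSense of sensor S & proc
  | PAct of actuator S & vterm & proc
  | PPar of proc & proc
  | PTOut of chan S & vterm & proc & proc
  | PTIn of chan S & proc & proc
  | PCond of guard & proc & proc
  | PVar of nat
  | PFix of proc.

Definition vshift (k : nat) (t : vterm) : vterm :=
  match t with
  | Val v => Val v
  | Var n => Var (if k <= n then n.+1 else n)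
  end.

Definition vsubst (k : nat) (w : val) (t : vterm) : vterm :=
  match t with
  | Val v => Val v
  | Var n => if n == k then Val w else Var (if k < n then n.-1 else n)
  end.

Definition gshift (k : nat) (b : guard) : guard := (b.1, map (vshift k) b.2).

Definition gsubst (k : nat) (w : val) (b : guard) : guard :=
  (b.1, map (vsubst k w) b.2).

Fixpoint close_args (ts : seq vterm) : option (seq val) :=
  match ts with
  | [::] => Some [::]
  | Val v :: ts' => omap (cons v) (close_args ts')
  | Var _ :: _ => None
  end.

(* [None] exactly when the guard is open. *)
Definition gtruth (b : guard) : option bool :=
  omap (guard_eval b.1) (close_args b.2).

Fixpoint pshiftv (k : nat) (P : proc) : proc :=
  match P with
  | PNil => PNil
  | PSigma P => PSigma (pshiftv k P)
  | PLoc P => PLoc (pshiftv k.+1 P)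
  | PSense s P => PSense s (pshiftv k.+1 P)
  | PAct a v P => PAct a (vshift k v) (pshiftv k P)
  | PPar P Q => PPar (pshiftv k P) (pshiftv k Q)
  | PTOut c v P Q => PTOut c (vshift k v) (pshiftv k P) (pshiftv k Q)
  | PTIn c P Q => PTIn c (pshiftv k.+1 P) (pshiftv k Q)
  | PCond b P Q => PCond (gshift k b) (pshiftv k P) (pshiftv k Q)
  | PVar n => PVar n
  | PFix P => PFix (pshiftv k P)
  end.

Fixpoint pshiftp (k : nat) (P : proc) : proc :=
  match P with
  | PNil => PNil
  | PSigma P => PSigma (pshiftp k P)
  | PLoc P => PLoc (pshiftp k P)
  | PSense s P => PSense s (pshiftp k P)
  | PAct a v P => PAct a v (pshiftp k P)
  | PPar P Q => PPar (pshiftp k P) (pshiftp k Q)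
  | PTOut c v P Q => PTOut c v (pshiftp k P) (pshiftp k Q)
  | PTIn c P Q => PTIn c (pshiftp k P) (pshiftp k Q)
  | PCond b P Q => PCond b (pshiftp k P) (pshiftp k Q)
  | PVar n => PVar (if k <= n then n.+1 else n)
  | PFix P => PFix (pshiftp k.+1 P)
  end.

(* P{w/x} for the value variable x of index k; [w] is closed, so it is never
   shifted. *)
Fixpoint psubstv (k : nat) (w : val) (P : proc) : proc :=
  match P with
  | PNil => PNil
  | PSigma P => PSigma (psubstv k w P)
  | PLoc P => PLoc (psubstv k.+1 w P)
  | PSense s P => PSense s (psubstv k.+1 w P)
  | PAct a v P => PAct a (vsubst k w v) (psubstv k w P)
  | PPar P Q => PPar (psubstv k w P) (psubstv k w Q)
  | PTOut c v P Q => PTOut c (vsubst k w v) (psubstv k w P) (psubstv k w Q)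
  | PTIn c P Q => PTIn c (psubstv k.+1 w P) (psubstv k w Q)
  | PCond b P Q => PCond (gsubst k w b) (psubstv k w P) (psubstv k w Q)
  | PVar n => PVar n
  | PFix P => PFix (psubstv k w P)
  end.

(* P{R/X} for the process variable X of index k. *)
Fixpoint psubstp (k : nat) (R P : proc) : proc :=
  match P with
  | PNil => PNil
  | PSigma P => PSigma (psubstp k R P)
  | PLoc P => PLoc (psubstp k (pshiftv 0 R) P)
  | PSense s P => PSense s (psubstp k (pshiftv 0 R) P)
  | PAct a v P => PAct a v (psubstp k R P)
  | PPar P Q => PPar (psubstp k R P) (psubstp k R Q)
  | PTOut c v P Q => PTOut c v (psubstp k R P) (psubstp k R Q)
  | PTIn c P Q => PTIn c (psubstp k (pshiftv 0 R) P) (psubstp k R Q)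
  | PCond b P Q => PCond b (psubstp k R P) (psubstp k R Q)
  | PVar n => if n == k then R else PVar (if k < n then n.-1 else n)
  | PFix P => PFix (psubstp k.+1 (pshiftp 0 R) P)
  end.

Definition unfold_fix (P : proc) : proc := psubstp 0 (PFix P) P.

Definition vclosed (x : nat) (t : vterm) : bool :=
  if t is Var n then n < x else true.

(* Value indices below [x] and process indices below [X]. *)
Fixpoint pclosed (x X : nat) (P : proc) : bool :=
  match P with
  | PNil => true
  | PSigma P => pclosed x X P
  | PLoc P => pclosed x.+1 X P
  | PSense _ P => pclosed x.+1 X P
  | PAct _ v P => vclosed x v && pclosed x X P
  | PPar P Q => pclosed x X P && pclosed x X Q
  | PTOut _ v P Q => [&& vclosed x v, pclosed x X P & pclosed x X Q]
  | PTIn _ P Q => pclosed x.+1 X P && pclosed x X Q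
  | PCond b P Q => [&& all (vclosed x) b.2, pclosed x X P & pclosed x X Q]
  | PVar n => n < X
  | PFix P => pclosed x X.+1 P
  end.

(* Every occurrence of the process variable of index [X] is time-guarded. *)
Fixpoint time_guarded (X : nat) (P : proc) : bool :=
  match P with
  | PNil => true
  | PSigma _ => true
  | PLoc P => time_guarded X P
  | PSense _ P => time_guarded X P
  | PAct _ _ P => time_guarded X P
  | PPar P Q => time_guarded X P && time_guarded X Q
  | PTOut _ _ P _ => time_guarded X P
  | PTIn _ P _ => time_guarded X P
  | PCond _ P Q => time_guarded X P && time_guarded X Q
  | PVar n => n != X
  | PFix P => time_guarded X.+1 P
  end.

Fixpoint fix_guarded (P : proc) : bool :=
  match P with
  | PNil => true
  | PSigma P => fix_guarded P
  | PLoc P => fix_guarded P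
  | PSense _ P => fix_guarded P
  | PAct _ _ P => fix_guarded P
  | PPar P Q => fix_guarded P && fix_guarded Q
  | PTOut _ _ P Q => fix_guarded P && fix_guarded Q
  | PTIn _ P Q => fix_guarded P && fix_guarded Q
  | PCond _ P Q => fix_guarded P && fix_guarded Q
  | PVar _ => true
  | PFix P => time_guarded 0 P && fix_guarded P
  end.

Fixpoint reads (s : sensor S) (P : proc) : bool :=
  match P with
  | PNil => false
  | PSigma P => reads s P
  | PLoc P => reads s P
  | PSense s' P => (s' == s) || reads s P
  | PAct _ _ P => reads s P
  | PPar P Q => reads s P || reads s Q
  | PTOut _ _ P Q => reads s P || reads s Q
  | PTIn _ P Q => reads s P || reads s Q
  | PCond _ P Q => reads s P || reads s Q
  | PVar _ => false
  | PFix P => reads s P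
  end.

Fixpoint writes (a : actuator S) (P : proc) : bool :=
  match P with
  | PNil => false
  | PSigma P => writes a P
  | PLoc P => writes a P
  | PSense _ P => writes a P
  | PAct a' _ P => (a' == a) || writes a P
  | PPar P Q => writes a P || writes a Q
  | PTOut _ _ P Q => writes a P || writes a Q
  | PTIn _ P Q => writes a P || writes a Q
  | PCond _ P Q => writes a P || writes a Q
  | PVar _ => false
  | PFix P => writes a P
  end.

Fixpoint pchans (P : proc) : seq (chan S) :=
  match P with
  | PNil => [::]
  | PSigma P => pchans P
  | PLoc P => pchans P
  | PSense _ P => pchans P
  | PAct _ _ P => pchans P
  | PPar P Q => pchans P ++ pchans Q
  | PTOut c _ P Q => c :: pchans P ++ pchans Q
  | PTIn c P Q => c :: pchans P ++ pchans Q
  | PCond _ P Q => pchans P ++ pchans Q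
  | PVar _ => [::]
  | PFix P => pchans P
  end.

Definition cren (c d e : chan S) : chan S := if e == c then d else e.

Fixpoint pren (c d : chan S) (P : proc) : proc :=
  match P with
  | PNil => PNil
  | PSigma P => PSigma (pren c d P)
  | PLoc P => PLoc (pren c d P)
  | PSense s P => PSense s (pren c d P)
  | PAct a v P => PAct a v (pren c d P)
  | PPar P Q => PPar (pren c d P) (pren c d Q)
  | PTOut e v P Q => PTOut (cren c d e) v (pren c d P) (pren c d Q)
  | PTIn e P Q => PTIn (cren c d e) (pren c d P) (pren c d Q)
  | PCond b P Q => PCond b (pren c d P) (pren c d Q)
  | PVar n => PVar n
  | PFix P => PFix (pren c d P)
  end.

Record iface := Iface {
  isens : sensor S -> option val;
  iact : actuator S -> option val
}.

Definition set_sens (J : iface) (s : sensor S) (v : val) : iface :=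
  Iface (fun s' => if s' == s then Some v else isens J s') (iact J).

Definition set_act (J : iface) (a : actuator S) (v : val) : iface :=
  Iface (isens J) (fun a' => if a' == a then Some v else iact J a').

Inductive net :=
  | NZero
  | NNode of node_name S & iface & proc & mobility & loc S
  | NPar of net & net
  | NRes of chan S & net.

Fixpoint names (M : net) : seq (node_name S) :=
  match M with
  | NZero => [::]
  | NNode n _ _ _ _ => [:: n]
  | NPar M N => names M ++ names N
  | NRes _ M => names M
  end.

Fixpoint has_actuator (a : actuator S) (M : net) : bool :=
  match M with
  | NZero => false
  | NNode _ J _ _ _ => isSome (iact J a)
  | NPar M N => has_actuator a M || has_actuator a N
  | NRes _ M => has_actuator a M
  end.

Fixpoint has_sensor (s : sensor S) (M : net) : bool :=
  match M with
  | NZero => false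
  | NNode _ J _ _ _ => isSome (isens J s)
  | NPar M N => has_sensor s M || has_sensor s N
  | NRes _ M => has_sensor s M
  end.

(* The last clause is the typing of interfaces: a sensor holds a value of its
   own domain. *)
Definition wf_node (J : iface) (P : proc) (mu : mobility) : Prop :=
  [/\ pclosed 0 0 P /\ fix_guarded P,
      forall s, reads s P -> isSome (isens J s),
      forall a, writes a P -> isSome (iact J a),
      forall s, loc_dependent s -> isSome (isens J s) -> mu = Stationary
    & forall s v, isens J s = Some v -> sensor_dom s v].

Fixpoint wf_nodes (M : net) : Prop :=
  match M with
  | NZero => True
  | NNode _ J P mu _ => wf_node J P mu
  | NPar M N =>
      [/\ wf_nodes M, wf_nodes N,
          forall a, ~~ (has_actuator a M && has_actuator a N)
        & forall s, ~~ loc_dependent s -> ~~ (has_sensor s M && has_sensor s N)]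
  | NRes _ M => wf_nodes M
  end.

(* Closed, well-formed networks. *)
Definition wf (M : net) : Prop := uniq (names M) /\ wf_nodes M.

Fixpoint free_chans (M : net) : seq (chan S) :=
  match M with
  | NZero => [::]
  | NNode _ _ P _ _ => pchans P
  | NPar M N => free_chans M ++ free_chans N
  | NRes c M => [seq d <- free_chans M | d != c]
  end.

Fixpoint all_chans (M : net) : seq (chan S) :=
  match M with
  | NZero => [::]
  | NNode _ _ P _ _ => pchans P
  | NPar M N => all_chans M ++ all_chans N
  | NRes c M => c :: all_chans M
  end.

(* Renames the free occurrences of c to d; capture-free if d is not in
   [all_chans M]. *)
Fixpoint nren (c d : chan S) (M : net) : net :=
  match M with
  | NZero => NZero
  | NNode n J P mu h => NNode n J (pren c d P) mu h
  | NPar M N => NPar (nren c d M) (nren c d N)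
  | NRes e M => if e == c then NRes e M else NRes e (nren c d M)
  end.

Inductive pcong : proc -> proc -> Prop :=
  | pc_refl P : pcong P P
  | pc_sym P Q : pcong P Q -> pcong Q P
  | pc_trans P Q R : pcong P Q -> pcong Q R -> pcong P R
  | pc_Sigma P P' : pcong P P' -> pcong (PSigma P) (PSigma P')
  | pc_Loc P P' : pcong P P' -> pcong (PLoc P) (PLoc P')
  | pc_Sense s P P' : pcong P P' -> pcong (PSense s P) (PSense s P')
  | pc_Act a v P P' : pcong P P' -> pcong (PAct a v P) (PAct a v P')
  | pc_Par P P' Q Q' :
      pcong P P' -> pcong Q Q' -> pcong (PPar P Q) (PPar P' Q')
  | pc_TOut c v P P' Q Q' :
      pcong P P' -> pcong Q Q' -> pcong (PTOut c v P Q) (PTOut c v P' Q')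
  | pc_TIn c P P' Q Q' :
      pcong P P' -> pcong Q Q' -> pcong (PTIn c P Q) (PTIn c P' Q')
  | pc_Cond b P P' Q Q' :
      pcong P P' -> pcong Q Q' -> pcong (PCond b P Q) (PCond b P' Q')
  | pc_Fix P P' : pcong P P' -> pcong (PFix P) (PFix P')
  | pc_ParC P Q : pcong (PPar P Q) (PPar Q P)
  | pc_ParA P Q R : pcong (PPar (PPar P Q) R) (PPar P (PPar Q R))
  | pc_ParN P : pcong (PPar P PNil) P
  | pc_CondT b P Q : gtruth b = Some true -> pcong (PCond b P Q) P
  | pc_CondF b P Q : gtruth b = Some false -> pcong (PCond b P Q) Q
  | pc_Unfold P : pcong (PFix P) (unfold_fix P).

(* [nc_Alpha] makes explicit the identification of networks up to
   alpha-conversion of restricted channels. *)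
Inductive ncong : net -> net -> Prop :=
  | nc_refl M : ncong M M
  | nc_sym M N : ncong M N -> ncong N M
  | nc_trans M N O : ncong M N -> ncong N O -> ncong M O
  | nc_Node n J P Q mu h :
      pcong P Q -> ncong (NNode n J P mu h) (NNode n J Q mu h)
  | nc_Par M M' N N' :
      ncong M M' -> ncong N N' -> ncong (NPar M N) (NPar M' N')
  | nc_Res c M M' : ncong M M' -> ncong (NRes c M) (NRes c M')
  | nc_ParC M N : ncong (NPar M N) (NPar N M)
  | nc_ParA M N O : ncong (NPar (NPar M N) O) (NPar M (NPar N O))
  | nc_Par0 M : ncong (NPar M NZero) M
  | nc_Res0 c : ncong (NRes c NZero) NZero
  | nc_ResC c d M : ncong (NRes c (NRes d M)) (NRes d (NRes c M))
  | nc_Extr c M N : c \notin free_chans M ->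
      ncong (NRes c (NPar M N)) (NPar M (NRes c N))
  | nc_Alpha c d M : d \notin all_chans M -> rng d = rng c ->
      ncong (NRes c M) (NRes d (nren c d M)).

(* The rules for sigma have negative premises on tau, and no other label
   depends on sigma; so the transitions with label different from sigma are
   defined first ([pstep], [nstep]) and the sigma transitions on top of them
   ([ptick], [ntick]). *)
Inductive plabel :=
  | LTau
  | LOut of chan S & val
  | LIn of chan S & val
  | LLoc of loc S
  | LSense of sensor S & val
  | LAct of actuator S & val.

Inductive pstep : proc -> plabel -> proc -> Prop :=
  | ps_Out c v P Q : pstep (PTOut c (Val v) P Q) (LOut c v) P
  | ps_In c v P Q : pstep (PTIn c P Q) (LIn c v) (psubstv 0 v P)
  | ps_Sense s v P : pstep (PSense s P) (LSense s v) (psubstv 0 v P)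
  | ps_Act a v P : pstep (PAct a (Val v) P) (LAct a v) P
  | ps_Loc h P : pstep (PLoc P) (LLoc h) (psubstv 0 (VLoc _ h) P)
  | ps_ComL c v P P' Q Q' :
      pstep P (LOut c v) P' -> pstep Q (LIn c v) Q' -> rng c = Internal ->
      pstep (PPar P Q) LTau (PPar P' Q')
  | ps_ComR c v P P' Q Q' :
      pstep P (LOut c v) P' -> pstep Q (LIn c v) Q' -> rng c = Internal ->
      pstep (PPar Q P) LTau (PPar Q' P')
  | ps_ParL l P P' Q : pstep P l P' -> pstep (PPar P Q) l (PPar P' Q)
  | ps_ParR l P P' Q : pstep P l P' -> pstep (PPar Q P) l (PPar Q P')
  | ps_Fix l P Q : pstep (unfold_fix P) l Q -> pstep (PFix P) l Q
  | ps_CondT l b P Q P' : gtruth b = Some true ->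
      pstep P l P' -> pstep (PCond b P Q) l P'
  | ps_CondF l b P Q Q' : gtruth b = Some false ->
      pstep Q l Q' -> pstep (PCond b P Q) l Q'.

Inductive ptick : proc -> proc -> Prop :=
  | pt_Nil : ptick PNil PNil
  | pt_Sigma P : ptick (PSigma P) P
  | pt_TOut c v P Q : ptick (PTOut c v P Q) Q
  | pt_TIn c P Q : ptick (PTIn c P Q) Q
  | pt_Par P P' Q Q' :
      ptick P P' -> ptick Q Q' -> (~ exists R, pstep (PPar P Q) LTau R) ->
      ptick (PPar P Q) (PPar P' Q')
  | pt_Fix P Q : ptick (unfold_fix P) Q -> ptick (PFix P) Q
  | pt_CondT b P Q P' : gtruth b = Some true ->
      ptick P P' -> ptick (PCond b P Q) P'
  | pt_CondF b P Q Q' : gtruth b = Some false ->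
      ptick Q Q' -> ptick (PCond b P Q) Q'.

(* [NLOut c v h] and [NLIn c v h] are the output and input of v on c at h. *)
Inductive nlabel :=
  | NLTau
  | NLAct of actuator S
  | NLOut of chan S & val & loc S
  | NLIn of chan S & val & loc S.

Definition label_chan (l : nlabel) : option (chan S) :=
  match l with
  | NLOut c _ _ => Some c
  | NLIn c _ _ => Some c
  | _ => None
  end.

Inductive nstep : net -> nlabel -> net -> Prop :=
  | ns_Loc n J P P' mu h : pstep P (LLoc h) P' ->
      nstep (NNode n J P mu h) NLTau (NNode n J P' mu h)
  | ns_Sense n J P P' mu h s v :
      isens J s = Some v -> pstep P (LSense s v) P' ->
      nstep (NNode n J P mu h) NLTau (NNode n J P' mu h)
  | ns_ActUnchg n J P P' mu h a v :
      iact J a = Some v -> pstep P (LAct a v) P' ->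
      nstep (NNode n J P mu h) NLTau (NNode n J P' mu h)
  | ns_ActChg n J P P' mu h a v w :
      iact J a = Some w -> w <> v -> pstep P (LAct a v) P' ->
      nstep (NNode n J P mu h) (NLAct a) (NNode n (set_act J a v) P' mu h)
  | ns_Tau n J P P' mu h : pstep P LTau P' ->
      nstep (NNode n J P mu h) NLTau (NNode n J P' mu h)
  | ns_Out n J P P' mu h c v :
      pstep P (LOut c v) P' -> range_ge0 (rng c) ->
      nstep (NNode n J P mu h) (NLOut c v h) (NNode n J P' mu h)
  | ns_In n J P P' mu h c v :
      pstep P (LIn c v) P' -> range_ge0 (rng c) ->
      nstep (NNode n J P mu h) (NLIn c v h) (NNode n J P' mu h)
  | ns_ComL M M' N N' c v h k :
      nstep M (NLOut c v k) M' -> nstep N (NLIn c v h) N' ->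
      in_range (dist h k) (rng c) ->
      nstep (NPar M N) NLTau (NPar M' N')
  | ns_ComR M M' N N' c v h k :
      nstep M (NLOut c v k) M' -> nstep N (NLIn c v h) N' ->
      in_range (dist h k) (rng c) ->
      nstep (NPar N M) NLTau (NPar N' M')
  | ns_ParL l M M' N : nstep M l M' -> nstep (NPar M N) l (NPar M' N)
  | ns_ParR l M M' N : nstep M l M' -> nstep (NPar N M) l (NPar N M')
  | ns_Res l c M M' : nstep M l M' -> label_chan l <> Some c ->
      nstep (NRes c M) l (NRes c M').

Inductive ntick : net -> net -> Prop :=
  | nt_Stat n J P P' h :
      ptick P P' -> (~ exists M, nstep (NNode n J P Stationary h) NLTau M) ->
      ntick (NNode n J P Stationary h) (NNode n J P' Stationary h)
  | nt_Mob n J P P' h k :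
      ptick P P' -> (~ exists M, nstep (NNode n J P Mobile h) NLTau M) ->
      dist h k <= delta S ->
      ntick (NNode n J P Mobile h) (NNode n J P' Mobile k)
  | nt_Zero : ntick NZero NZero
  | nt_Par M M' N N' :
      ntick M M' -> ntick N N' -> (~ exists O, nstep (NPar M N) NLTau O) ->
      ntick (NPar M N) (NPar M' N')
  | nt_Res c M M' : ntick M M' -> ntick (NRes c M) (NRes c M').

Definition barb (M : net) (a : actuator S) (v : val) (h : loc S) : Prop :=
  exists gs n J P mu M',
    ncong M (foldr NRes (NPar (NNode n J P mu h) M') gs) /\ iact J a = Some v.

(* M[s@h |-> v] *)
Fixpoint supdate (M : net) (s : sensor S) (h : loc S) (v : val) : net :=
  match M with
  | NZero => NZero
  | NNode n J P mu k =>
      if (k == h) && isSome (isens J s)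
      then NNode n (set_sens J s v) P mu k else NNode n J P mu k
  | NPar M N => NPar (supdate M s h v) (supdate N s h v)
  | NRes c M => NRes c (supdate M s h v)
  end.

Inductive elabel :=
  | ETau
  | ESigma
  | EAct of actuator S
  | EOut of chan S & val & loc S
  | EIn of chan S & val & loc S
  | ESense of sensor S & val & loc S
  | EBarb of actuator S & val & loc S.

Inductive estep : net -> elabel -> net -> Prop :=
  | es_Tau M M' : nstep M NLTau M' -> estep M ETau M'
  | es_Sigma M M' : ntick M M' -> estep M ESigma M'
  | es_Act a M M' : nstep M (NLAct a) M' -> estep M (EAct a) M'
  | es_Out c v h k M M' :
      nstep M (NLOut c v h) M' -> in_range (dist h k) (rng c) ->
      estep M (EOut c v k) M'
  | es_In c v h k M M' :
      nstep M (NLIn c v h) M' -> in_range (dist k h) (rng c) ->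
      estep M (EIn c v k) M'
  | es_Sense s v h M :
      sensor_dom s v -> estep M (ESense s v h) (supdate M s h v)
  | es_Barb a v h M : barb M a v h -> estep M (EBarb a v h) M.

Definition taus : net -> net -> Prop :=
  clos_refl_trans net (fun M M' => estep M ETau M').

Definition wstep (M : net) (l : elabel) (M' : net) : Prop :=
  exists M1 M2, [/\ taus M M1, estep M1 l M2 & taus M2 M'].

Definition wstep_hat (M : net) (l : elabel) (M' : net) : Prop :=
  if l is ETau then taus M M' else wstep M l M'.

(* A relation on (closed, well-formed) networks. *)
Definition bisimulation (R : net -> net -> Prop) : Prop :=
  [/\ forall M N, R M N -> wf M /\ wf N,
      forall M N, R M N -> R N M
    & forall M N l M', R M N -> estep M l M' ->
        exists2 N', wstep_hat N l N' & R M' N'].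

Definition bisimilar (M N : net) : Prop :=
  exists2 R, bisimulation R & R M N.

End Calculus.

(* Main.v *)
(** Parallel composition and restriction are handled by the obvious candidate
    relations. For a tick of M | O, M is tau-free, hence bisimilar to the
    state N1 from which N ==> N1 ticks; so N1 cannot communicate with O, since
    otherwise M could. A barb amounts to a node exposing the actuator value,
    because scope extrusion and alpha-conversion bring any node to the top.

    Sensor updates are subtler: M -s?v@h-> M[s@h |-> v] is only matched by N up
    to taus performed before and after the update, and those performed before
    it may read the old value of s. But a tau computation of N can be replayed
    from N[s@h |-> v] by interposing updates of s@h, so M[s@h |-> v] and
    N[s@h |-> v] reach each other, up to bisimilarity, by taus and updates.
    Time-guardedness bounds the number of taus by a rank that updates preserve;
    along such a cycle the taus can therefore be eliminated by descent. *)

Require Import Defs.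
From mathcomp Require Import all_boot zify.
From Stdlib Require Import Relation_Operators FunctionalExtensionality.

Set Implicit Arguments.
Unset Strict Implicit.
Unset Printing Implicit Defensive.

Ltac split_andb := repeat
  match goal with
  | H : is_true (_ && _) |- _ => case/andP: H => ? ?
  | |- is_true (_ && _) => apply/andP; split
  end.

Section Contextuality.

Context (S : cait).

Local Notation val := (value (base_value S) (loc S)).
Implicit Types (P Q R : proc S) (M N O K : net S) (J : iface S).
Implicit Types (s : sensor S) (a : actuator S) (c d : chan S) (h k : loc S).
Implicit Types (u v w : val).

(** * Substitution *)

Lemma vclosed_vshift i x (t : vterm S) :
  vclosed x t -> vclosed x.+1 (vshift i t).
Proof. by case: t => //= n; case: ifP; lia. Qed.

Lemma vclosed_vsubst i x w (t : vterm S) :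
  i <= x -> vclosed x.+1 t -> vclosed x (vsubst i w t).
Proof. by case: t => //= n; case: eqP => //= ne; case: ifP; lia. Qed.

Lemma all_vclosed_vshift i x (ts : seq (vterm S)) :
  all (vclosed x) ts -> all (vclosed x.+1) (map (vshift i) ts).
Proof. by rewrite all_map; apply: sub_all => t; exact: vclosed_vshift. Qed.

Lemma all_vclosed_vsubst i x w (ts : seq (vterm S)) :
  i <= x -> all (vclosed x.+1) ts -> all (vclosed x) (map (vsubst i w) ts).
Proof.
by move=> ix; rewrite all_map; apply: sub_all => t; exact: vclosed_vsubst.
Qed.

Lemma pclosed_pshiftv i x X P : pclosed x X P -> pclosed x.+1 X (pshiftv i P).
Proof.
by elim: P i x X => //=; intros; split_andb;
  eauto using vclosed_vshift, all_vclosed_vshift.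
Qed.

Lemma pclosed_pshiftp i x X P : pclosed x X P -> pclosed x X.+1 (pshiftp i P).
Proof.
by elim: P i x X => //=; intros; split_andb; eauto; case: ifP; lia.
Qed.

Lemma pclosed_psubstv i x X w P :
  i <= x -> pclosed x.+1 X P -> pclosed x X (psubstv i w P).
Proof.
by elim: P i x X => //=; intros; split_andb;
  eauto using vclosed_vsubst, all_vclosed_vsubst.
Qed.

Lemma pclosed_psubstp i x X R P :
  i <= X -> pclosed x X.+1 P -> pclosed x X R -> pclosed x X (psubstp i R P).
Proof.
elim: P i x X R => //=; intros; split_andb;
  eauto using pclosed_pshiftv, pclosed_pshiftp.
by case: eqP => //= ne; case: ifP; lia.
Qed.

Lemma pclosed_unfold P : pclosed 0 1 P -> pclosed 0 0 (unfold_fix P).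
Proof. by move=> cP; apply: pclosed_psubstp. Qed.

Lemma time_guarded_pshiftv i j P :
  time_guarded j (pshiftv i P) = time_guarded j P.
Proof. by elim: P i j => //=; intros; congr (_ && _). Qed.

Lemma time_guarded_psubstv i j w P :
  time_guarded j (psubstv i w P) = time_guarded j P.
Proof. by elim: P i j => //=; intros; congr (_ && _). Qed.

(** The shift vacates index [i], so the condition is vacuous. This covers a process substituted
    under a [PFix] binder. *)
Lemma time_guarded_pshiftp_eq i P : time_guarded i (pshiftp i P).
Proof. by elim: P i => //=; intros; split_andb; auto; case: ifP; lia. Qed.

Lemma time_guarded_pshiftp_lt i j P :
  j < i -> time_guarded j (pshiftp i P) = time_guarded j P.
Proof.
by elim: P i j => //=; intros; rewrite ?(H, H0) //; case: ifP; lia.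
Qed.

Lemma time_guarded_pshiftp_ge i j P :
  i <= j -> time_guarded j.+1 (pshiftp i P) = time_guarded j P.
Proof.
by elim: P i j => //=; intros; rewrite ?(H, H0) //; case: ifP; lia.
Qed.

Lemma time_guarded_psubstp i j R P :
  j < i -> time_guarded j P -> time_guarded j R ->
  time_guarded j (psubstp i R P).
Proof.
elim: P i j R => //=; intros; split_andb; auto;
  try by apply: H => //; rewrite ?time_guarded_pshiftv ?time_guarded_pshiftp_ge.
by case: eqP => //= ne; case: ifP; lia.
Qed.

Lemma fix_guarded_pshiftv i P : fix_guarded (pshiftv i P) = fix_guarded P.
Proof.
by elim: P i => //=; intros; rewrite ?time_guarded_pshiftv; try congr (_ && _).
Qed.

Lemma fix_guarded_psubstv i w P : fix_guarded (psubstv i w P) = fix_guarded P.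
Proof.
by elim: P i => //=; intros; rewrite ?time_guarded_psubstv; try congr (_ && _).
Qed.

Lemma fix_guarded_pshiftp i P : fix_guarded (pshiftp i P) = fix_guarded P.
Proof.
by elim: P i => //=; intros; rewrite ?time_guarded_pshiftp_lt //;
  try congr (_ && _).
Qed.

(** Only the [PFix] case needs an argument: below the binder [R] is shifted, hence avoids the bound
    variable and cannot break its time guards. *)
Lemma fix_guarded_psubstp i R P :
  fix_guarded P -> fix_guarded R -> fix_guarded (psubstp i R P).
Proof.
elim: P i R => //=; intros; split_andb; auto;
  try by apply: H; rewrite ?fix_guarded_pshiftv ?fix_guarded_pshiftp.
- by case: eqP.
- by rewrite time_guarded_psubstp // time_guarded_pshiftp_eq.
Qed.

Lemma fix_guarded_unfold P :
  time_guarded 0 P && fix_guarded P -> fix_guarded (unfold_fix P).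
Proof. by move=> gP; apply: fix_guarded_psubstp => //; case/andP: gP. Qed.

Lemma reads_pshiftv s i P : reads s (pshiftv i P) = reads s P.
Proof. by elim: P i => //=; intros; congr (_ || _). Qed.

Lemma reads_pshiftp s i P : reads s (pshiftp i P) = reads s P.
Proof. by elim: P i => //=; intros; congr (_ || _). Qed.

Lemma reads_psubstv s i w P : reads s (psubstv i w P) = reads s P.
Proof. by elim: P i => //=; intros; congr (_ || _). Qed.

Lemma reads_psubstp s i R P :
  reads s (psubstp i R P) -> reads s P || reads s R.
Proof.
elim: P i R => //=.
- by move=> P IH i R /IH; rewrite reads_pshiftv.
- by move=> s' P IH i R /orP[->//|/IH]; rewrite reads_pshiftv -orbA => ->; rewrite ?orbT.
- by move=> P IHP Q IHQ i R /orP[/IHP|/IHQ] /orP[]->; rewrite ?orbT.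
- by move=> c t P IHP Q IHQ i R /orP[/IHP|/IHQ] /orP[]->; rewrite ?orbT.
- by move=> c P IHP Q IHQ i R /orP[/IHP|/IHQ]; rewrite ?reads_pshiftv => /orP[]->;
    rewrite ?orbT.
- by move=> b P IHP Q IHQ i R /orP[/IHP|/IHQ] /orP[]->; rewrite ?orbT.
- by move=> n i R; case: eqP.
- by move=> P IH i R /IH; rewrite reads_pshiftp.
Qed.

Lemma reads_unfold s P : reads s (unfold_fix P) -> reads s P.
Proof. by move/reads_psubstp => /=; rewrite orbb. Qed.

Lemma writes_pshiftv a i P : writes a (pshiftv i P) = writes a P.
Proof. by elim: P i => //=; intros; congr (_ || _). Qed.

Lemma writes_pshiftp a i P : writes a (pshiftp i P) = writes a P.
Proof. by elim: P i => //=; intros; congr (_ || _). Qed.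

Lemma writes_psubstv a i w P : writes a (psubstv i w P) = writes a P.
Proof. by elim: P i => //=; intros; congr (_ || _). Qed.

Lemma writes_psubstp a i R P :
  writes a (psubstp i R P) -> writes a P || writes a R.
Proof.
elim: P i R => //=.
- by move=> P IH i R /IH; rewrite writes_pshiftv.
- by move=> s P IH i R /IH; rewrite writes_pshiftv.
- by move=> a' t P IH i R /orP[->//|/IH]; rewrite -orbA => ->; rewrite ?orbT.
- by move=> P IHP Q IHQ i R /orP[/IHP|/IHQ] /orP[]->; rewrite ?orbT.
- by move=> c t P IHP Q IHQ i R /orP[/IHP|/IHQ] /orP[]->; rewrite ?orbT.
- by move=> c P IHP Q IHQ i R /orP[/IHP|/IHQ]; rewrite ?writes_pshiftv => /orP[]->;
    rewrite ?orbT.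
- by move=> b P IHP Q IHQ i R /orP[/IHP|/IHQ] /orP[]->; rewrite ?orbT.
- by move=> n i R; case: eqP.
- by move=> P IH i R /IH; rewrite writes_pshiftp.
Qed.

Lemma writes_unfold a P : writes a (unfold_fix P) -> writes a P.
Proof. by move/writes_psubstp => /=; rewrite orbb. Qed.

(** * Preservation of well-formedness *)

Lemma pstep_pclosed P l P' : pstep P l P' -> pclosed 0 0 P -> pclosed 0 0 P'.
Proof.
by elim=> //=; intros; split_andb; auto using pclosed_psubstv, pclosed_unfold.
Qed.

Lemma ptick_pclosed P P' : ptick P P' -> pclosed 0 0 P -> pclosed 0 0 P'.
Proof. by elim=> //=; intros; split_andb; auto using pclosed_unfold. Qed.

Lemma pstep_fix_guarded P l P' : pstep P l P' -> fix_guarded P -> fix_guarded P'.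
Proof.
elim=> //=; intros; rewrite ?fix_guarded_psubstv //;
  try (by apply: H0; apply: fix_guarded_unfold); by split_andb; auto.
Qed.

Lemma ptick_fix_guarded P P' : ptick P P' -> fix_guarded P -> fix_guarded P'.
Proof.
elim=> //=; intros;
  try (by apply: H0; apply: fix_guarded_unfold); by split_andb; auto.
Qed.

Ltac split_orb := repeat
  match goal with H : is_true (_ || _) |- _ => case/orP: H => ? end.

Lemma pstep_reads s P l P' : pstep P l P' -> reads s P' -> reads s P.
Proof.
have sub i w Q : reads s (psubstv i w Q) -> reads s Q by rewrite reads_psubstv.
by elim=> //=; intros; split_orb; try (apply/orP); eauto using reads_unfold.
Qed.

Lemma ptick_reads s P P' : ptick P P' -> reads s P' -> reads s P.
Proof.
by elim=> //=; intros; split_orb; try (apply/orP); eauto using reads_unfold.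
Qed.

Lemma pstep_writes a P l P' : pstep P l P' -> writes a P' -> writes a P.
Proof.
have sub i w Q : writes a (psubstv i w Q) -> writes a Q by rewrite writes_psubstv.
by elim=> //=; intros; split_orb; try (apply/orP); eauto using writes_unfold.
Qed.

Lemma ptick_writes a P P' : ptick P P' -> writes a P' -> writes a P.
Proof.
by elim=> //=; intros; split_orb; try (apply/orP); eauto using writes_unfold.
Qed.


Lemma pstep_wf_node J P l P' mu :
  pstep P l P' -> wf_node J P mu -> wf_node J P' mu.
Proof.
move=> st [[cP gP] rP wP lJ dJ]; split=> //.
- by split; [apply: pstep_pclosed st cP | apply: pstep_fix_guarded st gP].
- by move=> s /(pstep_reads st)/rP.
- by move=> a /(pstep_writes st)/wP.
Qed.

Lemma ptick_wf_node J P P' mu : ptick P P' -> wf_node J P mu -> wf_node J P' mu.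
Proof.
move=> st [[cP gP] rP wP lJ dJ]; split=> //.
- by split; [apply: ptick_pclosed st cP | apply: ptick_fix_guarded st gP].
- by move=> s /(ptick_reads st)/rP.
- by move=> a /(ptick_writes st)/wP.
Qed.

Lemma wf_node_set_act J P mu a v :
  wf_node J P mu -> wf_node (set_act J a v) P mu.
Proof.
by case=> cP rP wP lJ dJ; split=> // a' /wP /=; case: ifP.
Qed.

(** As [s] is already defined, the update defines no new sensor, so the stationarity clause is
    untouched; [sensor_dom s v] preserves the typing clause. *)
Lemma wf_node_set_sens J P mu s v :
  sensor_dom s v -> isSome (isens J s) ->
  wf_node J P mu -> wf_node (set_sens J s v) P mu.
Proof.
move=> dv Js [cP rP wP lJ dJ]; split=> //= s'.
- by move/rP; case: ifP.
- by case: eqP => [->|_]; [move=> /lJ/(_ Js) | exact: lJ].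
- by move=> w; case: eqP => [-> [<-]|_ /dJ].
Qed.

(** All that well-formedness demands across distinct nodes depends on these three data, which
    transitions and updates leave fixed. *)
Definition same_static M N :=
  [/\ names M = names N, forall a, has_actuator a M = has_actuator a N
    & forall s, has_sensor s M = has_sensor s N].

Lemma same_static_refl M : same_static M M. Proof. by []. Qed.

Lemma same_static_NPar M M' N N' : same_static M M' -> same_static N N' ->
  same_static (NPar M N) (NPar M' N').
Proof.
move=> [nM aM sM] [nN aN sN]; split=> [|a|s] /=; first by rewrite nM nN.
- by rewrite aM aN.
- by rewrite sM sN.
Qed.

Lemma wf_nodes_NPar M M' N N' : same_static M M' -> same_static N N' ->
  wf_nodes M' -> wf_nodes N' -> wf_nodes (NPar M N) -> wf_nodes (NPar M' N').
Proof.
move=> [_ aM sM] [_ aN sN] wM' wN' [_ _ dA dS]; split=> // [a|s].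
- by rewrite -aM -aN.
- by rewrite -sM -sN; apply: dS.
Qed.

Lemma nstep_same_static M l M' : nstep M l M' -> same_static M M'.
Proof.
elim=> //; try by intros; apply: same_static_NPar.
(* Only an actuator change touches the interface, and it overwrites a value that was already
   defined. *)
move=> n J P P' mu h a v w Ja _ _; split=> // a' /=.
by case: eqP => // ->; rewrite Ja.
Qed.

Lemma ntick_same_static M M' : ntick M M' -> same_static M M'.
Proof. by elim=> //; intros; apply: same_static_NPar. Qed.

Lemma supdate_same_static M s h v : same_static M (supdate M s h v).
Proof.
elim: M => //= [n J P mu k|M IHM N IHN]; last exact: same_static_NPar.
case: ifP => // /andP[_ Js]; split=> // s' /=.
by case: eqP => // ->.
Qed.

Lemma nstep_wf_nodes M l M' : nstep M l M' -> wf_nodes M -> wf_nodes M'.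
Proof.
elim=> //=; try by intros; eauto using pstep_wf_node, wf_node_set_act.
- move=> {}M {}M' N N' c v h k stM IHM stN IHN _ wMN.
  have [/IHM wM /IHN wN _ _] := wMN.
  exact: wf_nodes_NPar (nstep_same_static stM) (nstep_same_static stN) wM wN wMN.
- move=> {}M {}M' N N' c v h k stM IHM stN IHN _ wMN.
  have [/IHN wN /IHM wM _ _] := wMN.
  exact: wf_nodes_NPar (nstep_same_static stN) (nstep_same_static stM) wN wM wMN.
- move=> {}l {}M {}M' N stM IHM wMN; have [/IHM wM wN _ _] := wMN.
  exact: wf_nodes_NPar (nstep_same_static stM) (same_static_refl N) wM wN wMN.
- move=> {}l {}M {}M' N stM IHM wMN; have [wN /IHM wM _ _] := wMN.
  exact: wf_nodes_NPar (same_static_refl N) (nstep_same_static stM) wN wM wMN.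
Qed.

Lemma ntick_wf_nodes M M' : ntick M M' -> wf_nodes M -> wf_nodes M'.
Proof.
elim=> //=; try by intros; eauto using ptick_wf_node.
move=> {}M {}M' N N' stM IHM stN IHN _ wMN.
  have [/IHM wM /IHN wN _ _] := wMN.
exact: wf_nodes_NPar (ntick_same_static stM) (ntick_same_static stN) wM wN wMN.
Qed.

Lemma supdate_wf_nodes M s h v :
  sensor_dom s v -> wf_nodes M -> wf_nodes (supdate M s h v).
Proof.
move=> dv; elim: M => //= [n J P mu k wJ|M IHM N IHN wMN].
  by case: ifP => // /andP[_ Js]; apply: wf_node_set_sens.
have [/IHM wM /IHN wN _ _] := wMN.
by apply: wf_nodes_NPar wM wN wMN; apply: supdate_same_static.
Qed.

Lemma estep_wf M l M' : estep M l M' -> wf M -> wf M'.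
Proof.
rewrite /wf; case=> {l M M'} //.
- by move=> M M' st [+ /(nstep_wf_nodes st)]; have [<-] := nstep_same_static st.
- by move=> M M' st [+ /(ntick_wf_nodes st)]; have [<-] := ntick_same_static st.
- by move=> a M M' st [+ /(nstep_wf_nodes st)]; have [<-] := nstep_same_static st.
- move=> c v h k M M' st _ [+ /(nstep_wf_nodes st)].
  by have [<-] := nstep_same_static st.
- move=> c v h k M M' st _ [+ /(nstep_wf_nodes st)].
  by have [<-] := nstep_same_static st.
- move=> s v h M dv [+ /(supdate_wf_nodes h dv)].
  by have [<-] := supdate_same_static M s h v.
Qed.

Lemma taus_wf M M' : taus M M' -> wf M -> wf M'.
Proof. by elim=> [M1 M2 /estep_wf| |M1 M2 M3 _ IH1 _ IH2 /IH1/IH2]. Qed.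

Lemma wstep_hat_wf M l M' : wstep_hat M l M' -> wf M -> wf M'.
Proof.
have wf_w : wstep M l M' -> wf M -> wf M'.
  by case=> M1 [M2 [t1 st t2]] /(taus_wf t1)/(estep_wf st)/(taus_wf t2).
by case: l wf_w => //= _ /taus_wf.
Qed.

(** * Weak transitions and bisimilarity *)

Lemma taus_refl M : taus M M. Proof. exact: rt_refl. Qed.

Lemma taus_trans M N O : taus M N -> taus N O -> taus M O.
Proof. exact: rt_trans. Qed.

Lemma nstep_taus M M' : nstep M (NLTau S) M' -> taus M M'.
Proof. by move=> st; apply: rt_step; apply: es_Tau. Qed.

Lemma taus_NParL M M' N : taus M M' -> taus (NPar M N) (NPar M' N).
Proof.
elim=> [M1 M2 st|M1|M1 M2 M3 _ IH1 _]; [|exact: taus_refl|exact: taus_trans].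
by inversion st; subst; apply/nstep_taus/ns_ParL.
Qed.

Lemma taus_NRes c M M' : taus M M' -> taus (NRes c M) (NRes c M').
Proof.
elim=> [M1 M2 st|M1|M1 M2 M3 _ IH1 _]; [|exact: taus_refl|exact: taus_trans].
by inversion st; subst; apply/nstep_taus/ns_Res.
Qed.

Lemma wstep_hat_taus M M1 l M2 M' :
  taus M M1 -> wstep_hat M1 l M2 -> taus M2 M' -> wstep_hat M l M'.
Proof.
move=> t1; have w : wstep M1 l M2 -> taus M2 M' -> wstep M l M'.
  move=> [M3 [M4 [t3 st t4]]] t2; exists M3, M4.
  by split=> //; [apply: taus_trans t3 | apply: taus_trans t2].
by case: l w => //= _ t2 t3; apply: taus_trans t3; apply: taus_trans t2.
Qed.

Lemma estep_wstep_hat M l M' : estep M l M' -> wstep_hat M l M'.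
Proof.
move=> st; have w : wstep M l M'.
  by exists M, M'; split=> //; apply: taus_refl.
by case: l st w => // st _; apply: rt_step.
Qed.

Lemma bisimilar_wf M N : bisimilar M N -> wf M /\ wf N.
Proof. by case=> R [wR _ _] /wR. Qed.

Lemma bisimilar_sym M N : bisimilar M N -> bisimilar N M.
Proof. by case=> R bR RMN; exists R => //; case: bR => _ sR _; apply: sR. Qed.

Lemma bisimilar_estep M N l M' : bisimilar M N -> estep M l M' ->
  exists2 N', wstep_hat N l N' & bisimilar M' N'.
Proof.
case=> R bR RMN st; have [_ _ /(_ _ _ _ _ RMN st)[N' wN RM'N']] := bR.
by exists N' => //; exists R.
Qed.

Lemma bisimilar_taus M N M' : bisimilar M N -> taus M M' ->
  exists2 N', taus N N' & bisimilar M' N'.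
Proof.
move=> + t; elim: t N => [M1 M2 st N /bisimilar_estep/(_ st)//|M1 N b|].
  by exists N => //; apply: taus_refl.
move=> M1 M2 M3 _ IH1 _ IH2 N /IH1[N1 t1 /IH2[N2 t2 b]].
by exists N2 => //; apply: taus_trans t2.
Qed.

Lemma bisimilar_wstep_hat M N l M' : bisimilar M N -> wstep_hat M l M' ->
  exists2 N', wstep_hat N l N' & bisimilar M' N'.
Proof.
move=> b.
have w : wstep M l M' -> exists2 N', wstep_hat N l N' & bisimilar M' N'.
  case=> M1 [M2 [t1 st t2]].
  have [N1 t1' b1] := bisimilar_taus b t1.
  have [N2 w2 b2] := bisimilar_estep b1 st.
  have [N3 t3' b3] := bisimilar_taus b2 t2.
  by exists N3 => //; apply: wstep_hat_taus t1' w2 t3'.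
by case: l w => //= _; apply: bisimilar_taus.
Qed.

Lemma bisimilar_trans M N O : bisimilar M N -> bisimilar N O -> bisimilar M O.
Proof.
move=> bMN bNO.
exists (fun A B => exists2 C, bisimilar A C & bisimilar C B); last by exists N.
split=> [A B [C /bisimilar_wf[wA _] /bisimilar_wf[_ wB]] //|A B [C bA bB]|].
  by exists C; apply: bisimilar_sym.
move=> A B l A' [C bA bB] st; have [C' wC bA'] := bisimilar_estep bA st.
by have [B' wB bB'] := bisimilar_wstep_hat bB wC; exists B' => //; exists C'.
Qed.

(** Transitions preserve well-formedness, so it may be assumed of the two targets when relating
    them. *)
Lemma bisimilar_coind (R : net S -> net S -> Prop) :
  (forall M N, R M N -> R N M) -> (forall M N, R M N -> wf M) ->
  (forall M N l M', R M N -> estep M l M' ->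
     exists2 N', wstep_hat N l N' & wf M' -> wf N' -> R M' N') ->
  forall M N, R M N -> bisimilar M N.
Proof.
move=> sR wR stR M N RMN; exists R => //; split=> // [A B RAB|A B l A' RAB st].
  by split; [apply: wR RAB | exact: wR (sR _ _ RAB)].
have [B' wB RB] := stR _ _ _ _ RAB st; exists B' => //; apply: RB.
  by apply: estep_wf st _; apply: wR RAB.
by apply: wstep_hat_wf wB _; exact: wR (sR _ _ RAB).
Qed.

Lemma wstep_wstep_hat M l M' : wstep M l M' -> wstep_hat M l M'.
Proof.
case: l => // -[M1 [M2 [t1 st t2]]].
by apply: taus_trans t1 (taus_trans _ t2); apply: rt_step.
Qed.

Lemma wstep_hatP M l M' :
  wstep_hat M l M' -> l = ETau S /\ taus M M' \/ wstep M l M'.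
Proof. by case: l => /=; auto. Qed.

(** Two contexts are allowed because the surrounding network may itself move during the strong step.
    The premise [taus M A] is what the tick of a parallel composition relies on. *)
Lemma wstep_lift (f g : net S -> net S) l l' M M' :
  (forall A B, taus A B -> taus (f A) (f B)) ->
  (forall A B, taus A B -> taus (g A) (g B)) ->
  (forall A B, taus M A -> estep A l B -> estep (f A) l' (g B)) ->
  wstep M l M' -> wstep (f M) l' (g M').
Proof.
move=> ft gt fg [M1 [M2 [t1 st t2]]]; exists (f M1), (g M2).
by split; [exact: ft | exact: fg | exact: gt].
Qed.
(** * Barbs *)

(** A barb without structural congruence, so that it can be read off each component. *)
Fixpoint exposes M a v h : Prop :=
  match M with
  | NZero => False
  | NNode _ J _ _ k => k = h /\ iact J a = Some v
  | NPar M N => exposes M a v h \/ exposes N a v h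
  | NRes _ M => exposes M a v h
  end.

Lemma exposes_nren c d M a v h : exposes (nren c d M) a v h <-> exposes M a v h.
Proof. by elim: M => //= [M IHM N IHN|e M IHM]; [tauto | case: ifP]. Qed.

Lemma exposes_ncong M N a v h : ncong M N -> exposes M a v h <-> exposes N a v h.
Proof.
elim=> //=; try by intros; tauto.
by move=> c d {}M _ _; rewrite exposes_nren.
Qed.

(** The shape [barb] requires below the restrictions. The node and its process stay existential so
    that channel renaming preserves it. *)
Definition node_par a v h M :=
  exists n J P mu M', M = NPar (NNode n J P mu h) M' /\ iact J a = Some v.

Lemma node_par_nren a v h c d M : node_par a v h M -> node_par a v h (nren c d M).
Proof.
by case=> n [J [P [mu [M' [-> Ja]]]]]; exists n, J, (pren c d P), mu, (nren c d M').
Qed.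

(** Renaming either stops at a restriction of [c] or reaches the body; the prefix [gs] is kept in
    both cases. *)
Lemma nren_foldr_NRes a v h c d gs M : node_par a v h M ->
  exists2 M', node_par a v h M' &
    nren c d (foldr (@NRes S) M gs) = foldr (@NRes S) M' gs.
Proof.
move=> eM; elim: gs => [|g gs [M' eM' IH]] /=.
  by exists (nren c d M) => //; apply: node_par_nren.
by case: ifP => _; [exists M | exists M' => //; rewrite IH].
Qed.

(** Scope extrusion, one restriction at a time. The induction generalizes over [M] because
    alpha-conversion alters the body. *)
Lemma foldr_NRes_NPar a v h gs M N : node_par a v h M ->
  exists gs' M', node_par a v h M' /\
    ncong (NPar (foldr (@NRes S) M gs) N) (foldr (@NRes S) M' gs').
Proof.
elim: gs M => [|g gs IH] M eM /=.
  have [n [J [P [mu [M' [-> Ja]]]]]] := eM.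
  exists [::], (NPar (NNode n J P mu h) (NPar M' N)); split; last exact: nc_ParA.
  by exists n, J, P, mu, (NPar M' N).
set L := foldr _ M gs.
(* Avoiding [all_chans L] makes the renaming capture-free; avoiding [free_chans N] permits extrusion
   over [N]. *)
have [d] := rng_fresh g (all_chans L ++ free_chans N).
rewrite mem_cat negb_or => /andP[dL dN] rd.
have [M1 eM1 EL] := nren_foldr_NRes g d gs eM.
have [gs' [M' [eM' c']]] := IH _ eM1.
exists (d :: gs'), M'; split=> //=.
apply: nc_trans (nc_Par (nc_Alpha dL rd) (nc_refl N)) _; rewrite EL.
apply: nc_trans (nc_ParC _ _) _.
apply: nc_trans (nc_sym (nc_Extr _ dN)) _.
by apply: nc_Res; apply: nc_trans (nc_ParC _ _) c'.
Qed.

Lemma exposes_foldr M a v h : exposes M a v h ->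
  exists gs M', node_par a v h M' /\ ncong M (foldr (@NRes S) M' gs).
Proof.
elim: M => //= [n J P mu k [-> Ja]|M IHM N IHN|c M IHM].
- exists [::], (NPar (NNode n J P mu h) (NZero S)); split.
    by exists n, J, P, mu, (NZero S).
  exact/nc_sym/nc_Par0.
- case=> [/IHM|/IHN] [gs [L [eL cL]]].
    have [gs' [M' [eM' c']]] := foldr_NRes_NPar gs N eL.
    exists gs', M'; split=> //.
    exact: nc_trans (nc_Par cL (nc_refl N)) c'.
  have [gs' [M' [eM' c']]] := foldr_NRes_NPar gs M eL.
  exists gs', M'; split=> //; apply: nc_trans (nc_ParC _ _) _.
  exact: nc_trans (nc_Par cL (nc_refl M)) c'.
- move=> /IHM[gs [L [eL cL]]]; exists (c :: gs), L; split=> //.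
  exact: nc_Res.
Qed.

Lemma barbE M a v h : barb M a v h <-> exposes M a v h.
Proof.
split=> [[gs [n [J [P [mu [M' [cM Ja]]]]]]]|].
  by apply/(exposes_ncong a v h cM); elim: gs {cM} => //=; left.
move=> /exposes_foldr[gs [_ [[n [J [P [mu [M' [-> Ja]]]]]] cM]]].
by exists gs, n, J, P, mu, M'.
Qed.

(** * Restriction *)

Lemma bisimilar_NRes c M N : bisimilar M N -> bisimilar (NRes c M) (NRes c N).
Proof.
pose R A B := exists M N, [/\ A = NRes c M, B = NRes c N & bisimilar M N].
move=> b; apply: (@bisimilar_coind R); last by exists M, N.
- move=> _ _ [A [B [-> -> bAB]]]; exists B, A; split=> //; exact: bisimilar_sym.
- by move=> _ _ [A [B [-> _ /bisimilar_wf[]]]].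
move=> _ _ l L [A [B [-> -> bAB]]] st.
(* Each transition of [NRes c A] comes from one of [A] with the same label; since [l] is then known
   to pass the restriction, any [l] step of any network lifts back. *)
suff [A' [LE stA lift]] : exists A', [/\ L = NRes c A', estep A l A'
    & forall B B', estep B l B' -> estep (NRes c B) l (NRes c B')].
  have [B' wB bAB'] := bisimilar_estep bAB stA.
  exists (NRes c B'); last by move=> _ _; exists A', B'.
  have [[lE t]|w] := wstep_hatP wB; first by rewrite lE; apply: taus_NRes.
  apply: wstep_wstep_hat.
  by apply: (wstep_lift (@taus_NRes c) (@taus_NRes c) _ w) => X Y _ /lift.
inversion st as [? ? s1|? ? s1|a ? ? s1|e v h k ? ? s1 r|e v h k ? ? s1 r
                |s v h ? dv|a v h ? s1]; subst.
- inversion s1; subst; exists M'; split=> //; first exact: es_Tau.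
  by move=> X Y sX; inversion sX; subst; apply/es_Tau/ns_Res.
- inversion s1; subst; exists M'; split=> //; first exact: es_Sigma.
  by move=> X Y sX; inversion sX; subst; apply/es_Sigma/nt_Res.
- inversion s1; subst; exists M'; split=> //; first exact: es_Act.
  by move=> X Y sX; inversion sX; subst; apply/es_Act/ns_Res.
- inversion s1; subst; exists M'; split=> //; first exact: es_Out r.
  by move=> X Y sX; inversion sX; subst; apply: es_Out; first apply: ns_Res; eauto.
- inversion s1; subst; exists M'; split=> //; first exact: es_In r.
  by move=> X Y sX; inversion sX; subst; apply: es_In; first apply: ns_Res; eauto.
- exists (supdate A s h v); split=> //; first exact: es_Sense.
  by move=> X Y sX; inversion sX; subst; apply: (@es_Sense _ _ _ _ (NRes c X)).
- exists A; split=> //; first by apply: es_Barb; apply/barbE; move/barbE: s1.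
  by move=> X Y sX; inversion sX; subst; apply/es_Barb/barbE => /=; apply/barbE.
Qed.

(** * Parallel composition *)

(** The negative premises settle nodes and compositions; a tau of a restricted network is a tau of
    its body. *)
Lemma ntick_no_tau M M' : ntick M M' -> ~ exists M'', nstep M (NLTau S) M''.
Proof.
elim=> // {M M'}; first by case=> M st; inversion st.
by move=> c M M' _ IH [M'' st]; inversion st; subst; apply: IH; eexists; eassumption.
Qed.

Lemma no_tau_taus M M' :
  ~ (exists M'', nstep M (NLTau S) M'') -> taus M M' -> M' = M.
Proof.
move=> + t; elim: t => // [M1 M2 st no_tau|M1 M2 M3 _ IH1 _ IH2 no_tau].
  by case: no_tau; inversion st; subst; exists M2.
by have M12 := IH1 no_tau; subst; apply: IH2.
Qed.

(* If M can tick, it is tau-free, so it is matched by itself along N ==> N'. *)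
Lemma bisimilar_no_tau M N N' : bisimilar M N ->
  ~ (exists M', nstep M (NLTau S) M') -> taus N N' -> bisimilar M N'.
Proof.
move=> b no_tau t; have [M' tM bM] := bisimilar_taus (bisimilar_sym b) t.
by apply: bisimilar_sym; rewrite -(no_tau_taus no_tau tM).
Qed.

(** The extensional label records the observer's location [h], not the sender's, so [M] may answer
    from another [k'] within range; being tau-free, it answers at once. *)
Lemma bisimilar_out_no_tau M N c v h k N' : bisimilar M N ->
  ~ (exists M', nstep M (NLTau S) M') ->
  nstep N (NLOut c v k) N' -> in_range (dist h k) (rng c) ->
  exists k' M', nstep M (NLOut c v k') M' /\ in_range (dist h k') (rng c).
Proof.
(* Communication measures the distance from receiver to sender, whereas [es_Out] measures it from
   sender to observer. *)
move=> b no_tau st r; rewrite dist_sym in r.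
have [M' [M1 [M2 [t1 st1 _]]] _] := bisimilar_estep (bisimilar_sym b) (es_Out st r).
rewrite (no_tau_taus no_tau t1) in st1.
inversion st1 as [| | |? ? k' ? ? ? s1 r1| | | ]; subst.
by exists k', M2; rewrite dist_sym.
Qed.

Lemma bisimilar_in_no_tau M N c v h k N' : bisimilar M N ->
  ~ (exists M', nstep M (NLTau S) M') ->
  nstep N (NLIn c v h) N' -> in_range (dist h k) (rng c) ->
  exists h' M', nstep M (NLIn c v h') M' /\ in_range (dist h' k) (rng c).
Proof.
move=> b no_tau st r; rewrite dist_sym in r.
have [M' [M1 [M2 [t1 st1 _]]] _] := bisimilar_estep (bisimilar_sym b) (es_In st r).
rewrite (no_tau_taus no_tau t1) in st1.
inversion st1 as [| | | |? ? h' ? ? ? s1 r1| | ]; subst.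
by exists h', M2; rewrite dist_sym.
Qed.

(** A communication of [N] with [O] would be one of [M] with [O]: [M] matches the action observed at
    the location of [O]. A tau of [O] alone is present in both compositions. *)
Lemma bisimilar_NPar_no_tau M N O : bisimilar M N ->
  ~ (exists M', nstep M (NLTau S) M') -> ~ (exists N', nstep N (NLTau S) N') ->
  ~ (exists L, nstep (NPar M O) (NLTau S) L) ->
  ~ (exists L, nstep (NPar N O) (NLTau S) L).
Proof.
move=> b nM nN nMO [L st].
inversion st as [| | | | | | |? N' ? O' c v h k sN sO r|? O' ? N' c v h k sO sN r
                |? ? N' ? sN|? ? O' ? sO|]; subst.
- have [k' [M1 [sM r']]] := bisimilar_out_no_tau b nM sN r.
  by apply: nMO; eexists; apply: ns_ComL sM sO r'.
- have [h' [M1 [sM r']]] := bisimilar_in_no_tau b nM sN r.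
  by apply: nMO; eexists; apply: ns_ComR sO sM r'.
- by apply: nN; exists N'.
- by apply: nMO; exists (NPar M O'); apply: ns_ParR.
Qed.

Lemma bisimilar_NPar M N O : bisimilar M N -> wf (NPar M O) -> wf (NPar N O) ->
  bisimilar (NPar M O) (NPar N O).
Proof.
pose R A B := exists M N O,
  [/\ A = NPar M O, B = NPar N O, bisimilar M N, wf A & wf B].
move=> b wMO wNO; apply: (@bisimilar_coind R); last by exists M, N, O.
- move=> _ _ [A [B [C [-> -> /bisimilar_sym bAB wA wB]]]].
  by exists B, A, C.
- by move=> A B [? [? [? []]]].
move=> _ _ l L {M N O b wMO wNO} [M [N [O [-> -> b _ _]]]] st.
suff [M' [N' [O' [LE w bMN]]]] : exists M' N' O',
    [/\ L = NPar M' O', wstep_hat (NPar N O) l (NPar N' O') & bisimilar M' N'].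
  by exists (NPar N' O') => // wL wN'; exists M', N', O'; rewrite -LE.
(* The label [l0] of [M] may differ from [l]: in a communication [M] performs an input or output
   while the composition performs a tau. *)
have left_move l0 M' O' : estep M l0 M' -> l0 <> ETau S ->
    (forall B C, taus N B -> estep B l0 C -> estep (NPar B O) l (NPar C O')) ->
    L = NPar M' O' -> exists M' N' O',
    [/\ L = NPar M' O', wstep_hat (NPar N O) l (NPar N' O') & bisimilar M' N'].
  move=> sM l0E lift LE; have [N' wN bN] := bisimilar_estep b sM.
  have [[//]|{}wN] := wstep_hatP wN.
  exists M', N', O'; split=> //; apply: wstep_wstep_hat.
  exact: (wstep_lift (fun A B => @taus_NParL A B O)
                     (fun A B => @taus_NParL A B O') lift wN).
have right_move O' : estep (NPar N O) l (NPar N O') -> L = NPar M O' ->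
    exists M' N' O',
    [/\ L = NPar M' O', wstep_hat (NPar N O) l (NPar N' O') & bisimilar M' N'].
  by move=> sN LE; exists M, N, O'; split=> //; apply: estep_wstep_hat.
inversion st as [? ? s1|? ? s1|a ? ? s1|e v h k ? ? s1 r|e v h k ? ? s1 r
                |s v h ? dv|a v h ? s1]; subst.
- inversion s1 as [| | | | | | |? M' ? O' c v h k sM sO r|? O' ? M' c v h k sO sM r
                  |? ? M' ? sM|? ? O' ? sO|]; subst.
  + rewrite dist_sym in r; apply: (left_move _ _ O' (es_Out sM r)) => // B C _ sB.
    inversion sB as [| | |? ? k' ? ? ? sB1 r1| | |]; subst; apply: es_Tau.
    by apply: ns_ComL sB1 sO _; rewrite dist_sym.
  + rewrite dist_sym in r; apply: (left_move _ _ O' (es_In sM r)) => // B C _ sB.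
    inversion sB as [| | | |? ? k' ? ? ? sB1 r1| |]; subst; apply: es_Tau.
    by apply: ns_ComR sO sB1 _; rewrite dist_sym.
  + have [N' tN bN] := bisimilar_estep b (es_Tau sM).
    by exists M', N', O; split=> //; apply: taus_NParL.
  + by apply: right_move => //; apply/es_Tau/ns_ParR.
- inversion s1 as [| | |? M' ? O' tM tO nt|]; subst.
  have nM := ntick_no_tau tM.
  apply: (left_move _ _ O' (es_Sigma tM)) => // B C tB sB.
  inversion sB as [|? ? tB1| | | | |]; subst.
  apply/es_Sigma/nt_Par => //.
  have nB := ntick_no_tau tB1.
  (* The state [B] from which the tick occurs is still bisimilar to [M], because [M] is tau-free. *)
  exact: (bisimilar_NPar_no_tau (bisimilar_no_tau b nM tB) nM nB nt).
- inversion s1 as [| | | | | | | | |? ? M' ? sM|? ? O' ? sO|]; subst.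
  + apply: (left_move _ _ O (es_Act sM)) => // B C _ sB.
    by inversion sB; subst; apply/es_Act/ns_ParL.
  + by apply: right_move => //; apply/es_Act/ns_ParR.
- inversion s1 as [| | | | | | | | |? ? M' ? sM|? ? O' ? sO|]; subst.
  + apply: (left_move _ _ O (es_Out sM r)) => // B C _ sB.
    by inversion sB; subst; apply: es_Out; first apply: ns_ParL; eauto.
  + by apply: right_move => //; apply: es_Out r; apply: ns_ParR.
- inversion s1 as [| | | | | | | | |? ? M' ? sM|? ? O' ? sO|]; subst.
  + apply: (left_move _ _ O (es_In sM r)) => // B C _ sB.
    by inversion sB; subst; apply: es_In; first apply: ns_ParL; eauto.
  + by apply: right_move => //; apply: es_In r; apply: ns_ParR.
- apply: (left_move _ _ (supdate O s h v) (es_Sense h M dv)) => // B C _ sB.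
  by inversion sB; subst; apply: (@es_Sense _ _ _ _ (NPar B O)).
- move/barbE: s1 => /= -[/barbE sM|sO].
  + apply: (left_move _ _ O (es_Barb sM)) => // B C _ sB.
    by inversion sB; subst; apply/es_Barb/barbE => /=; left; apply/barbE.
  + by apply: right_move => //; apply/es_Barb/barbE; right.
Qed.

(** * Sensor updates *)

(* Bounds the number of instantaneous actions before the next tick: the
   time-guarded subterms do not count, so unfolding fix does not change it. *)
Fixpoint depth P : nat :=
  match P with
  | PNil => 0
  | PSigma _ => 0
  | PLoc P => (depth P).+1
  | PSense _ P => (depth P).+1
  | PAct _ _ P => (depth P).+1
  | PPar P Q => depth P + depth Q
  | PTOut _ _ P _ => (depth P).+1
  | PTIn _ P _ => (depth P).+1
  | PCond _ P Q => depth P + depth Q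
  | PVar _ => 0
  | PFix P => depth P
  end.

Fixpoint rank M : nat :=
  match M with
  | NZero => 0
  | NNode _ _ P _ _ => depth P
  | NPar M N => rank M + rank N
  | NRes _ M => rank M
  end.

Lemma depth_psubstv i w P : depth (psubstv i w P) = depth P.
Proof. by elim: P i => //=; auto. Qed.

(** Every replaced occurrence lies in a continuation that [depth] ignores. *)
Lemma depth_psubstp i R P : time_guarded i P -> depth (psubstp i R P) = depth P.
Proof.
elim: P i R => //=; intros; split_andb; auto.
by case: eqP H.
Qed.

Lemma pstep_depth P l P' : pstep P l P' -> fix_guarded P -> depth P' < depth P.
Proof.
elim=> //=; try by intros; rewrite ?depth_psubstv.
- move=> c v {}P {}P' Q Q' _ IHP _ IHQ _ /andP[/IHP + /IHQ]; lia.
- move=> c v {}P {}P' Q Q' _ IHP _ IHQ _ /andP[/IHQ + /IHP]; lia.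
- move=> {}l {}P {}P' Q _ IH /andP[/IH + _]; lia.
- move=> {}l {}P {}P' Q _ IH /andP[_ /IH]; lia.
- move=> {}l {}P Q _ IH gP; have /IH := fix_guarded_unfold gP.
  by rewrite depth_psubstp //; case/andP: gP.
- move=> {}l b {}P Q {}P' _ _ IH /andP[/IH + _]; lia.
- move=> {}l b {}P Q {}P' _ _ IH /andP[_ /IH]; lia.
Qed.

Lemma nstep_rank M l M' : nstep M l M' -> wf_nodes M -> rank M' < rank M.
Proof.
elim=> //=; try by move=> n J P P' *; apply: pstep_depth; [eassumption|];
  match goal with H : wf_node _ _ _ |- _ => case: H => -[] end.
- move=> {}M {}M' N N' c v h k _ IHM _ IHN _ [/IHM + /IHN + _ _]; lia.
- move=> {}M {}M' N N' c v h k _ IHM _ IHN _ [/IHN + /IHM + _ _]; lia.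
- move=> {}l {}M {}M' N _ IH [/IH + _ _ _]; lia.
- move=> {}l {}M {}M' N _ IH [_ /IH + _ _]; lia.
Qed.

Lemma taus_rank M M' : taus M M' -> wf M -> rank M' <= rank M.
Proof.
elim=> // [M1 M2 st [_ wM]|M1 M2 M3 t1 IH1 _ IH2 wM].
  by inversion st as [? ? s1| | | | | |]; subst; apply/ltnW/(nstep_rank s1).
by apply: leq_trans (IH2 (taus_wf t1 wM)) (IH1 wM).
Qed.

Lemma taus_rank_eq M M' : taus M M' -> wf M -> rank M <= rank M' -> M' = M.
Proof.
elim=> // [M1 M2 st [_ wM]|M1 M2 M3 t1 IH1 t2 IH2 wM le13].
  by inversion st as [? ? s1| | | | | |]; subst; rewrite leqNgt (nstep_rank s1 wM).
have wM2 := taus_wf t1 wM.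
have E21 : M2 = M1 by apply: IH1 => //; apply: leq_trans le13 (taus_rank t2 wM2).
by rewrite -E21; apply: IH2 => //; rewrite E21.
Qed.

Lemma rank_supdate M s h v : rank (supdate M s h v) = rank M.
Proof. by elim: M => //= [n J P mu k|M -> N ->] //; case: ifP. Qed.

Lemma set_sens_set_sens J s v w : set_sens (set_sens J s v) s w = set_sens J s w.
Proof.
rewrite /set_sens /=; congr Iface; apply: functional_extensionality => s'.
by case: eqP.
Qed.

Lemma supdate_supdate M s h v w :
  supdate (supdate M s h v) s h w = supdate M s h w.
Proof.
elim: M => //= [n J P mu k|M -> N ->//|c M ->//].
case: (boolP ((k == h) && isSome (isens J s))) => /= [/andP[-> Js]|/negbTE->//] /=.
by rewrite eqxx set_sens_set_sens.
Qed.

(* The transitions whose label is not tau do not look at the sensors. *)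
Lemma nstep_supdate M l M' s h u : nstep M l M' -> l <> NLTau S ->
  nstep (supdate M s h u) l (supdate M' s h u).
Proof.
elim=> //=.
- move=> n J P P' mu k a v w Ja wv st _.
  case: ifP => _; last exact: ns_ActChg Ja wv st.
  exact: (@ns_ActChg _ _ (set_sens J s u) _ _ _ _ _ _ _ Ja wv st).
- by move=> n J P P' mu k c v st r _; case: ifP => _; apply: ns_Out.
- by move=> n J P P' mu k c v st r _; case: ifP => _; apply: ns_In.
- by move=> {}l {}M {}M' N _ IH /IH; apply: ns_ParL.
- by move=> {}l {}M {}M' N _ IH /IH; apply: ns_ParR.
- by move=> {}l c {}M {}M' _ IH lc /IH st; apply: ns_Res.
Qed.

(* A tau transition reads at most one sensor of one node, so it survives the
   update of s@h to the value read by that node. *)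
Lemma nstep_tau_supdate M M' s h v : wf_nodes M -> sensor_dom s v ->
  nstep M (NLTau S) M' ->
  exists2 u, sensor_dom s u &
    nstep (supdate M s h u) (NLTau S) (supdate M' s h u).
Proof.
move=> + dv st; move: {-1}(NLTau S) (erefl (NLTau S)) st => l + st.
elim: st => {M l M'} //=.
- move=> n J P P' mu k st _ _; exists v => //.
  by case: ifP => _; apply: ns_Loc.
- move=> n J P P' mu k s' w Js st _ [_ _ _ _ dJ].
  have [E|ne] := eqVneq s' s.
    (* The value currently read is in the domain of [s] by the typing of interfaces. *)
    subst s'; exists w; first exact: dJ.
    by case: ifP => _; apply: ns_Sense st => //=; rewrite eqxx.
  exists v => //; case: ifP => _; apply: ns_Sense st => //=.
  by rewrite (negbTE ne).
- move=> n J P P' mu k a w Ja st _ _; exists v => //.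
  by case: ifP => _; apply: ns_ActUnchg st.
- move=> n J P P' mu k st _ _; exists v => //.
  by case: ifP => _; apply: ns_Tau.
- move=> M M' N N' c w k k' sM _ sN _ r _ _; exists v => //.
  by apply: ns_ComL (nstep_supdate _ _ _ sM _) (nstep_supdate _ _ _ sN _) r.
- move=> M M' N N' c w k k' sM _ sN _ r _ _; exists v => //.
  by apply: ns_ComR (nstep_supdate _ _ _ sM _) (nstep_supdate _ _ _ sN _) r.
- by move=> l M M' N _ IH lE [/(IH lE)[u du st] _ _ _]; exists u => //;
    apply: ns_ParL.
- by move=> l M M' N _ IH lE [_ /(IH lE)[u du st] _ _]; exists u => //;
    apply: ns_ParR.
- by move=> l c M M' _ IH lc lE /(IH lE)[u du st]; exists u => //;
    apply: ns_Res.
Qed.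

(** The moves allowed in replaying a computation after [s] at [h] has been updated; each update is
    itself a visible move that a bisimilar network must match. *)
Definition tau_or_update s h M M' : Prop :=
  nstep M (NLTau S) M' \/ exists2 u, sensor_dom s u & M' = supdate M s h u.

Definition reach s h : net S -> net S -> Prop :=
  clos_refl_trans (net S) (tau_or_update s h).

Lemma reach_refl s h M : reach s h M M. Proof. exact: rt_refl. Qed.

Lemma reach_trans s h M N O : reach s h M N -> reach s h N O -> reach s h M O.
Proof. exact: rt_trans. Qed.

Lemma reach_update s h M u : sensor_dom s u -> reach s h M (supdate M s h u).
Proof. by move=> du; apply: rt_step; right; exists u. Qed.

Lemma reach_taus s h M M' : taus M M' -> reach s h M M'.
Proof.
elim=> [M1 M2 st|M1|M1 M2 M3 _ IH1 _]; [|exact: reach_refl|exact: reach_trans].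
by inversion st; subst; apply: rt_step; left.
Qed.

Lemma wstep_sense M s v h M' : wstep M (ESense s v h) M' ->
  exists M1, [/\ sensor_dom s v, taus M M1 & taus (supdate M1 s h v) M'].
Proof. by case=> M1 [M2 [t1 st t2]]; inversion st; subst; exists M1. Qed.

Lemma reach_wstep_sense M s v h M' :
  wstep M (ESense s v h) M' -> reach s h M M'.
Proof.
move=> /wstep_sense[M1 [dv t1 t2]]; apply: reach_trans (reach_taus s h t1) _.
exact: reach_trans (reach_update h M1 dv) (reach_taus s h t2).
Qed.

Lemma reach_supdate_taus M M' s h v : wf M -> sensor_dom s v -> taus M M' ->
  reach s h (supdate M s h v) (supdate M' s h v).
Proof.
move=> + dv t; elim: t => [M1 M2 st [_ wM]|M1 _|M1 M2 M3 t1 IH1 _ IH2 wM].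
- inversion st as [? ? s1| | | | | |]; subst.
  have [u du su] := nstep_tau_supdate h wM dv s1.
  apply: reach_trans (reach_update h _ du) _; rewrite supdate_supdate.
  apply: reach_trans (rt_step _ _ _ _ (or_introl su)) _.
  by rewrite -(supdate_supdate M2 s h u v); apply: reach_update.
- exact: reach_refl.
- exact: reach_trans (IH1 wM) (IH2 (taus_wf t1 wM)).
Qed.

Lemma bisimilar_reach s h M N M' : bisimilar M N -> reach s h M M' ->
  exists2 N', reach s h N N' & bisimilar M' N'.
Proof.
move=> + t; elim: t N => [M1 M2 [st|[u du ->]] N b|M1 N b|].
- have [N' /(reach_taus s h) tN bN] := bisimilar_estep b (es_Tau st).
  by exists N'.
- have [N' /reach_wstep_sense tN bN] := bisimilar_estep b (es_Sense h M1 du).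
  by exists N'.
- by exists N => //; apply: reach_refl.
- move=> M1 M2 M3 _ IH1 _ IH2 N /IH1[N1 t1 /IH2[N2 t2 b]].
  by exists N2 => //; apply: reach_trans t2.
Qed.

Lemma reach_wf s h M M' : reach s h M M' -> wf M -> wf M'.
Proof.
elim=> // [M1 M2 [st|[u du ->]]|M1 M2 M3 _ IH1 _ IH2 /IH1/IH2//].
  exact: estep_wf (es_Tau st).
exact: estep_wf (es_Sense h M1 du).
Qed.

Lemma reach_rank s h M M' : reach s h M M' -> wf M -> rank M' <= rank M.
Proof.
elim=> // [M1 M2 [st|[u du ->]] [_ wM]|M1 M2 M3 t1 IH1 _ IH2 wM].
- exact/ltnW/(nstep_rank st).
- by rewrite rank_supdate.
- exact: leq_trans (IH2 (reach_wf t1 wM)) (IH1 wM).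
Qed.

(** A tau would lower the rank, so only updates of [s] at [h] occurred, and the final update
    overwrites them. *)
Lemma reach_rank_eq s h M M' v : reach s h M M' -> wf M -> rank M <= rank M' ->
  supdate M' s h v = supdate M s h v.
Proof.
elim=> // [M1 M2 [st|[u du ->]] [_ wM]|M1 M2 M3 t1 IH1 t2 IH2 wM le13].
- by rewrite leqNgt (nstep_rank st wM).
- by rewrite supdate_supdate.
have wM2 := reach_wf t1 wM.
rewrite IH2 //; last by apply: leq_trans (reach_rank t1 wM) le13.
by rewrite IH1 //; apply: leq_trans le13 (reach_rank t2 wM2).
Qed.

Lemma wstep_sense_rank_eq M s v h M' : wstep M (ESense s v h) M' -> wf M ->
  rank M <= rank M' -> M' = supdate M s h v.
Proof.
move=> /wstep_sense[M1 [dv t1 t2]] wM; have wM1 := taus_wf t1 wM.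
have wM1v := estep_wf (es_Sense h M1 dv) wM1.
move=> le; have le' := leq_trans le (taus_rank t2 wM1v).
rewrite rank_supdate in le'; have E := taus_rank_eq t1 wM le'; subst M1.
by apply: taus_rank_eq t2 wM1v _; rewrite rank_supdate.
Qed.

(** The taus that [N] performs before its update are replayed after it by [reach_supdate_taus];
    those performed afterwards follow unchanged. *)
Lemma bisimilar_supdate_reach M N s h v : bisimilar M N -> sensor_dom s v ->
  exists2 N', reach s h (supdate N s h v) N' & bisimilar (supdate M s h v) N'.
Proof.
move=> b dv; have [_ wN] := bisimilar_wf b.
have [N' /wstep_sense[N1 [_ t1 t2]] bN] := bisimilar_estep b (es_Sense h M dv).
exists N' => //; apply: reach_trans (reach_supdate_taus h wN dv t1) _.
exact: reach_taus.
Qed.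

(* From some K bisimilar to M[s@h |-> v], match in turn: the update to v, the
   passage to N[s@h |-> v], again the update to v, and the passage back. If the
   rank drops, start again from the network of smaller rank so reached;
   otherwise only updates occurred, and both K[s@h |-> v] ~ M[s@h |-> v] and
   K[s@h |-> v] ~ N[s@h |-> v]. *)
Lemma bisimilar_supdate M N s h v : bisimilar M N -> sensor_dom s v ->
  bisimilar (supdate M s h v) (supdate N s h v).
Proof.
move=> b dv; have bMN := bisimilar_sym b.
have [Mv rM bNM] := bisimilar_supdate_reach h bMN dv.
have [Nv rN bMNv] := bisimilar_supdate_reach h b dv.
have [K bK] : exists K, bisimilar (supdate M s h v) K by exists Nv.
have [n le_n] := ubnP (rank K); elim: n => // n IH in K bK le_n *.
have [_ wK] := bisimilar_wf bK.
have [K' wKK' bK'] := bisimilar_estep bK (es_Sense h (supdate M s h v) dv).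
rewrite supdate_supdate in bK'.
have [K1 rK1 bK1] := bisimilar_reach bK' rM.
have {}bK1 := bisimilar_trans bNM bK1.
have [K1' wK1' bK1'] := bisimilar_estep bK1 (es_Sense h (supdate N s h v) dv).
rewrite supdate_supdate in bK1'.
have [K2 rK2 bK2] := bisimilar_reach bK1' rN.
have {}bK2 := bisimilar_trans bMNv bK2.
have [lt|le] := ltnP (rank K2) (rank K).
  by apply: (IH K2) => //; apply: leq_trans lt _.
have [_ wK'] := bisimilar_wf bK'; have [_ wK1] := bisimilar_wf bK1.
have [_ wK1'f] := bisimilar_wf bK1'.
have leK' := reach_rank (reach_wstep_sense wKK') wK.
have leK1 := reach_rank rK1 wK'.
have leK1' := reach_rank (reach_wstep_sense wK1') wK1.
have leK2 := reach_rank rK2 wK1'f.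
(* The ranks of [K], [K'], [K1], [K1'], [K2] decrease weakly and the last is at least the first, so
   all are equal. *)
have E' : K' = supdate K s h v by apply: wstep_sense_rank_eq wKK' wK _; lia.
have E1' : K1' = supdate K1 s h v by apply: wstep_sense_rank_eq wK1' wK1 _; lia.
have E1 : supdate K1 s h v = supdate K s h v.
  have le1 : rank K' <= rank K1 by lia.
  by rewrite (reach_rank_eq v rK1 wK' le1) E' supdate_supdate.
apply: bisimilar_trans bK' _; rewrite E' -E1 -E1'; exact: bisimilar_sym.
Qed.

End Contextuality.

Theorem theorem3 (S : cait) (M N : net S) (hMN : bisimilar M N) :
  (forall O : net S, wf (NPar M O) -> wf (NPar N O) ->
     bisimilar (NPar M O) (NPar N O)) /\
  (forall c : chan S, bisimilar (NRes c M) (NRes c N)) /\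
  (forall (s : sensor S) (h : loc S) (v : value (base_value S) (loc S)),
     sensor_dom s v -> bisimilar (supdate M s h v) (supdate N s h v)).
Proof.
split; first by move=> O; apply: bisimilar_NPar.
split=> [c|s h v dv]; first exact: bisimilar_NRes.
exact: bisimilar_supdate.
Qed.
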